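(* Let $G = D_n = \langle a, b \mid a^n = b^2 = 1,\ bab = a^{-1} \rangle$ be the dihedral group of order $2n$. Let $H$ be a connecting set for the graph $\mathrm{Cay}(G,H)$, and let $M$ and $N$ be the $n \times n$ blocks of the adjacency matrix of $\mathrm{Cay}(G,H)$ defined in the context. Then $\mathrm{null}(\mathrm{Cay}(G,H)) = \mathrm{null}(M+N) + \mathrm{null}(M-N)$.
   Context: For a finite group $G$, a subset $H \subseteq G$ is called a connecting set if (i) $H^{-1} = \{h^{-1} : h \in H\} = H$, (ii) $1_G \notin H$, and (iii) $H$ generates $G$. The Cayley graph $\mathrm{Cay}(G,H)$ is the graph with vertex set $G$ in which $u, v \in G$ are adjacent if and only if $vu^{-1} \in H$. For $G = D_n$ let $C_n = \langle a \rangle$ and order the vertices as $1, a, \dots, a^{n-1}, b, ab, \dots, a^{n-1}b$. With respect to the partition $G = C_n \cup C_n b$ the adjacency matrix has the block form $A = \begin{pmatrix} M & N \\ N^t & M \end{pmatrix}$, where $M$ is the $n \times n$ block with rows and columns indexed by $C_n$, $N$ is the $n \times n$ block with rows indexed by $C_n$ and columns indexed by $C_n b$, and $N^t$ is the transpose of $N$. The nullity $\mathrm{null}(X)$ of a square matrix $X$ is the dimension of its null space, and $\mathrm{null}(\Gamma)$ of a graph $\Gamma$ is the nullity of its adjacency matrix. *)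

(* Defs.v *)
From HB Require Import structures.
From mathcomp Require Import all_boot all_order all_algebra all_fingroup.
Set Implicit Arguments.
Unset Strict Implicit.
Unset Printing Implicit Defensive.

Import GroupScope GRing.Theory.

(* [cokermx X] has the null space {v | X v = 0} as its column space. *)
Definition nullity (F : fieldType) (n : nat) (X : 'M[F]_n) : nat :=
  \rank (cokermx X).

(* [v] is the ordering of the vertices; it is meant to be bijective. *)
Definition adjacency_mx (F : fieldType) (T : finType) (e : rel T) (m : nat)
    (v : 'I_m -> T) : 'M[F]_m :=
  (\matrix_(i, j) (e (v i) (v j))%:R)%R.

(* Another ordering of the vertices conjugates the adjacency matrix by a
   permutation matrix, so the choice of [enum_val] is immaterial. *)
Definition graph_nullity (F : fieldType) (T : finType) (e : rel T) : nat :=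
  nullity (adjacency_mx F e (enum_val : 'I_#|T| -> T)).

Definition connecting_set (gT : finGroupType) (H : {set gT}) : Prop :=
  [/\ H^-1 = H, 1 \notin H & <<H>> = [set: gT]].

Definition cayley (gT : finGroupType) (H : {set gT}) : rel gT :=
  fun u v => v * u^-1 \in H.

(* A group generated by [a] and [b] subject to these relations is a quotient of
   the group <a, b | a^n = b^2 = 1, bab = a^-1>, which has order 2n for n >= 1;
   the order condition (which excludes n = 0) makes it that group itself.
   Using elements of an arbitrary [gT] rather than the library's ['D_(2 * n)]
   covers n = 1 and names the generators. *)
Definition dihedral (gT : finGroupType) (n : nat) (a b : gT) : Prop :=
  [/\ #|gT| = (2 * n)%N, <<[set a; b]>> = [set: gT],
      a ^+ n = 1, b ^+ 2 = 1 & b * a * b = a^-1].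

(* The ordering 1, a, ..., a^(n-1), b, ab, ..., a^(n-1)b. *)
Definition dihedral_vertex (gT : finGroupType) (n : nat) (a b : gT)
    (k : 'I_(n + n)) : gT :=
  match split k with
  | inl i => a ^+ i
  | inr j => a ^+ j * b
  end.

Definition dihedral_cayley_mx (F : fieldType) (gT : finGroupType) (n : nat)
    (a b : gT) (H : {set gT}) : 'M[F]_(n + n) :=
  adjacency_mx F (cayley H) (@dihedral_vertex gT n a b).

(* Main.v *)
(** Ordering [D_n] as [1, a, ..., a^(n-1), b, ab, ..., a^(n-1)b], the relation
    [b a^-i = a^i b] shows that the adjacency matrix is [[M, N], [N, M]] with
    [N] symmetric. Conjugation by [[1, 1], [1, -1]] turns it into
    [diag(M + N, M - N)], whose nullity is the sum of those of the blocks. *)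
Require Import Defs.
From HB Require Import structures.
From mathcomp Require Import all_boot all_order all_algebra all_fingroup.
Set Implicit Arguments.
Unset Strict Implicit.
Unset Printing Implicit Defensive.

Import Order.TTheory GRing.Theory Num.Theory.
Local Open Scope ring_scope.

Lemma nullityE (F : fieldType) (n : nat) (X : 'M[F]_n) :
  nullity X = (n - \rank X)%N.
Proof. exact: mxrank_coker. Qed.

Lemma rank_block_mx_sym (F : fieldType) (n : nat) (M N : 'M[F]_n) :
  2%:R != 0 :> F -> \rank (block_mx M N N M) = (\rank (M + N)%R + \rank (M - N)%R)%N.
Proof.
(* Since [P] squares to twice the identity, it is its own inverse up to a nonzero scalar. So
   [P *m A *m P] can replace a true conjugation, and no inverse is computed. *)
move=> nz2; pose P : 'M[F]_(n + n) := block_mx 1%:M 1%:M 1%:M (- 1%:M).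
have PP : P *m P = 2%:R%:M.
  rewrite mulmx_block !mulmxN !mulNmx !mulmx1 opprK subrr -mulr2n -raddfMn.
  by rewrite -scalar_mx_block.
have uP : P \in unitmx.
  have [] := @mulmx1_unit _ _ P (2%:R^-1 *: P) => //.
  by rewrite -scalemxAr PP scale_scalar_mx mulVf.
have PAP : P *m block_mx M N N M *m P
           = 2%:R *: block_mx (M + N) 0 0 (M - N).
  rewrite !mulmx_block scale_block_mx !scaler0 !mulNmx !mul1mx !mulmxN !mulmx1.
  by rewrite !scaler_nat !mulr2n (addrC N M) -(opprB M N) opprK !subrr.
rewrite -rank_diag_block_mx -[RHS](mxrank_scale_nz _ nz2) -PAP.
by rewrite mxrankMfree ?row_free_unit // (eqmxMfull _ _) ?row_full_unit.
Qed.

(** Bridges [enum_val] and the dihedral ordering. The sizes [m] and [p] are separate because [#|gT|]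
    and [n + n] are provably equal but not convertible. *)
Lemma nullity_adjacency_mx (F : fieldType) (T : finType) (e : rel T)
    (m p : nat) (v : 'I_m -> T) (w : 'I_p -> T) :
  bijective v -> bijective w ->
  nullity (adjacency_mx F e v) = nullity (adjacency_mx F e w).
Proof.
move=> bv bw; have Emp : m = p.
  by rewrite -(card_ord m) -(card_ord p) (bij_eq_card bv) (bij_eq_card bw).
case: p / Emp w bw => w [w' wK w'K]; have injs : injective (w' \o v).
  by apply: inj_comp; [exact: can_inj w'K | exact: bij_inj].
have -> : adjacency_mx F e v
          = row_perm (perm injs) (col_perm (perm injs) (adjacency_mx F e w)).
  by apply/matrixP=> i j; rewrite !mxE !permE /= !w'K.
rewrite !nullityE row_permE col_permE; congr (_ - _)%N.
rewrite (eqmxMfull _ _) ?row_full_unit ?unitmx_perm //.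
by rewrite mxrankMfree // row_free_unit unitmx_perm.
Qed.

Section Dihedral.

Variables (gT : finGroupType) (n : nat) (a b : gT).
Hypothesis hG : dihedral n a b.
Local Open Scope group_scope.

Lemma dihedral_invb : b^-1 = b.
Proof. by case: hG => _ _ _ b2 _; apply/eqP; rewrite eq_invg_mul -expg2 b2. Qed.

Lemma dihedral_conj : a ^ b = a^-1.
Proof. by case: hG => _ _ _ _ <-; rewrite conjgE dihedral_invb mulgA. Qed.

Lemma dihedral_mulbV i : b * (a ^+ i)^-1 = a ^+ i * b.
Proof.
by rewrite -expgVn -dihedral_conj -conjXg conjgE mulVKg.
Qed.

(** As [b] normalises [<[a]>], every element lies in [<[a]> * <[b]>]; reducing exponents modulo [n]
    and 2 gives surjectivity. Counting does the rest, without computing the orders of [a] and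
    [b]. *)
Lemma dihedral_vertex_bij : bijective (@dihedral_vertex gT n a b).
Proof.
case: hG => cardG genG an b2 _.
have n0 : (0 < n)%N.
  by rewrite -(ltn_pmul2l (isT : 0 < 2)%N) muln0 -cardG; apply/card_gt0P; exists 1.
have sur g : exists k, @dihedral_vertex gT n a b k == g.
  have : g \in <[a]> * <[b]>.
    have nab : <[b]> \subset 'N(<[a]>).
      by rewrite cycle_subG; apply/normP; rewrite -cycleJ dihedral_conj cycleV.
    by rewrite -(norm_joinEr nab) joing_idl joing_idr joingE genG inE.
  case/mulsgP=> _ _ /cycleP[i ->] /cycleP[j ->] ->.
  have lin : (i %% n < n)%N by rewrite ltn_mod.
  rewrite -(expg_mod i an) -(expg_mod j b2) modn2.
  case: (odd j).
    exists (rshift n (Ordinal lin)).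
    by rewrite /dihedral_vertex (unsplitK (inr _)) expg1.
  exists (lshift n (Ordinal lin)).
  by rewrite /dihedral_vertex (unsplitK (inl _)) expg0 mulg1.
pose f g := xchoose (sur g).
have fK : cancel f (@dihedral_vertex gT n a b).
  by move=> g; apply/eqP/(xchooseP (sur g)).
have cardE : (#|'I_(n + n)| <= #|gT|)%N.
  by rewrite card_ord cardG mul2n addnn.
(* The section [f] is injective between sets of equal size, hence bijective, so its left inverse
   [dihedral_vertex] is two-sided. *)
have [h fh hf] := inj_card_bij (can_inj fK) cardE.
by exists f => // k; rewrite -{1}(hf k) fK hf.
Qed.

Lemma dihedral_cayley_mx_block (F : fieldType) (H : {set gT})
    (A := dihedral_cayley_mx F n a b H) :
  A = block_mx (ulsubmx A) (ursubmx A) (ursubmx A) (ulsubmx A).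
Proof.
rewrite -[LHS]submxK; congr block_mx; apply/matrixP=> i j; rewrite !mxE;
  rewrite /cayley /dihedral_vertex !(unsplitK (inl _)) !(unsplitK (inr _));
  rewrite invMg dihedral_invb.
(* Off the diagonal, [a^j (a^i b)^-1] and [a^j b a^-i] both equal [a^(i+j) b]. *)
- rewrite dihedral_mulbV -mulgA dihedral_mulbV !mulgA -!expgD.
  by rewrite addnC.
(* In the lower right block the two factors [b] cancel, leaving [a^j a^-i] as in the upper left. *)
- by rewrite -mulgA -{1}dihedral_invb mulKg.
Qed.

End Dihedral.

Theorem corollary3p2 (F : numFieldType) (gT : finGroupType) (n : nat)
    (a b : gT) (H : {set gT})
    (hG : dihedral n a b) (hH : connecting_set H) :
  let A := dihedral_cayley_mx F n a b H in
  let M := ulsubmx A in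
  let N := ursubmx A in
  graph_nullity F (cayley H) = (nullity (M + N) + nullity (M - N))%N.
Proof.
move=> A M N; rewrite /graph_nullity.
rewrite (nullity_adjacency_mx F _ (enum_val_bij gT) (dihedral_vertex_bij hG)).
rewrite -/(dihedral_cayley_mx F n a b H) (dihedral_cayley_mx_block hG).
rewrite !nullityE rank_block_mx_sym ?pnatr_eq0 //.
(* Subtraction is truncated, so splitting [n + n] minus the two ranks needs each rank to be at most
   [n]. *)
by rewrite subnDA -addnBAC ?rank_leq_row // -addnBA ?rank_leq_row.
Qed.
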